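(* Let $n\geq 4$ be an integer and let $\lambda>-1/2$ be a real number. Let $x_{nn}(\lambda)$ denote the largest zero of the Gegenbauer (ultraspherical) polynomial $P_n^{(\lambda)}$. Then $$1-x_{nn}^2(\lambda)<\frac{2(2\lambda+1)(2\lambda+3)(2\lambda+7)}{(10\lambda+17)\big[n(n+2\lambda)+\frac{1}{8}(2\lambda+1)^2\big]}.$$
   Context: For $\lambda>-1/2$, the Gegenbauer (ultraspherical) polynomial $P_n^{(\lambda)}$ of degree $n$ is, up to a nonzero constant factor (irrelevant for its zeros), the Jacobi polynomial $P_n^{(\alpha,\alpha)}$ with $\alpha=\lambda-\frac12$, where $$P_n^{(\alpha,\beta)}(x)=\frac{(\alpha+1)_n}{n!}\sum_{k=0}^{n}\frac{(-n)_k\,(n+\alpha+\beta+1)_k}{k!\,(\alpha+1)_k}\Big(\frac{1-x}{2}\Big)^k,$$ with $(a)_0=1$ and $(a)_k=a(a+1)\cdots(a+k-1)$. Equivalently, it is the degree-$n$ orthogonal polynomial on $[-1,1]$ with respect to the weight $(1-x^2)^{\lambda-1/2}$. Its zeros are real, simple and lie in $(-1,1)$; they are denoted $x_{1n}(\lambda)<x_{2n}(\lambda)<\cdots<x_{nn}(\lambda)$. The notation $x_{nn}^2(\lambda)$ means $(x_{nn}(\lambda))^2$. *)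

(* Defs.v *)
From mathcomp Require Import all_boot all_order all_algebra.
From mathcomp Require Import classical_sets reals.

Set Implicit Arguments.
Unset Strict Implicit.
Unset Printing Implicit Defensive.

Import Order.TTheory GRing.Theory Num.Theory.

Local Open Scope classical_set_scope.
Local Open Scope ring_scope.

Definition pochhammer (R : realType) (a : R) (k : nat) : R :=
  \prod_(i < k) (a + i%:R).

(* The division by (a + 1)_k is a genuine one when a > -1. *)
Definition jacobi (R : realType) (n : nat) (a b : R) : {poly R} :=
  (pochhammer (a + 1) n / (n`!)%:R) *:
  \sum_(k < n.+1)
    ((pochhammer (- n%:R) k * pochhammer (n%:R + a + b + 1) k) /
     ((k`!)%:R * pochhammer (a + 1) k)) *: (2^-1 *: (1 - 'X)) ^+ k.

(* Normalized as a Jacobi polynomial: the classical normalization differs by a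
   constant factor, which does not affect the zeros (and which vanishes at
   l = 0 for n > 0). *)
Definition gegenbauer (R : realType) (n : nat) (l : R) : {poly R} :=
  jacobi n (l - 2^-1) (l - 2^-1).

(* When p is nonzero and has a real zero, its set of zeros is finite and
   nonempty, so that this supremum is a maximum; sup is 0 on the empty set. *)
Definition largest_zero (R : realType) (p : {poly R}) : R :=
  sup [set x : R | root p x].

(* Main.v *)
Require Import Defs.
From mathcomp Require Import all_boot all_order all_algebra.
From mathcomp Require Import classical_sets reals.
From mathcomp Require Import ring lra boolp polyrcf.

Set Implicit Arguments.
Unset Strict Implicit.
Unset Printing Implicit Defensive.

Import Order.TTheory GRing.Theory Num.Theory.

Local Open Scope ring_scope.

(* Put t = 1 - x^2, c = l + 1/2 and q = n (n + 2 l) / 4. As a function f of t, the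
   polynomial solves t (1 - t) f'' + (c - (c + 1/2) t) f' + q f = 0, so that
   u = - f'/f = S1 + S2 t + S3 t^2 + ... solves the Riccati equation
     t (1 - t) (u' - u^2) + (c - (c + 1/2) t) u = q;
   the S_k are the power sums of the reciprocals of the zeros of f, and the bound
   is a simplification of t <= S3 / S4 for the least zero t. Neither the reality of
   the zeros nor the power sums are needed: the Pade-like truncation
     v = S1 + S2 t + S3 t^2 / (1 - t S4 / S3)
   is a subsolution of the Riccati equation, so u >= v as long as f > 0, and v
   blows up at t = S3 / S4. In polynomial terms, with v = N / D and f > 0, the
   quantity 2 x (f' D + f N) is positive where D = 0 and must increase with x at its
   first zero, although it vanishes at x = 1. *)

(** * Algebraic identities: the Riccati defect and the derivative of the barrier *)

(* The defect of v in the Riccati equation, times - D^2: the recurrences cancel its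
   coefficients up to t^3. *)
Lemma riccati_defect (R : realFieldType) (c q S1 S2 S3 S4 t : R) :
  q = c * S1 -> (c + 1) * S2 = (c + 1 / 2) * S1 + S1 ^+ 2 ->
  (c + 2) * S3 = (c + 3 / 2) * S2 + 2 * S1 * S2 - S1 ^+ 2 ->
  (c + 3) * S4 = (c + 5 / 2) * S3 + 2 * S1 * S3 + S2 ^+ 2 - 2 * S1 * S2 ->
  let m1 := S1 * S4 - S2 * S3 in let m2 := S2 * S4 - S3 ^+ 2 in
  let D := S3 - S4 * t in let N := S1 * S3 - m1 * t - m2 * t ^+ 2 in
  let N' := - m1 - 2 * m2 * t in
  t * (1 - t) * (N ^+ 2 - N' * D - S4 * N) - (c - (c + 1 / 2) * t) * N * D
    + q * D ^+ 2 =
  t ^+ 4 * (2 * m1 * m2 * (1 - t) + m2 ^+ 2 * t * (1 - t)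
    + ((2 * S1 * S3 + (c + 3 / 2) * S4) * m2 - m1 ^+ 2)).
Proof.
move=> R1 R2 R3 R4 m1 m2 D N N'; apply/eqP; rewrite -subr_eq0; apply/eqP.
(* The residual of each recurrence enters with its power of [t] times [D ^+ 2], truncated after
   [t ^+ 3]. *)
have -> : t * (1 - t) * (N ^+ 2 - N' * D - S4 * N) - (c - (c + 1 / 2) * t) * N * D
    + q * D ^+ 2 - t ^+ 4 * (2 * m1 * m2 * (1 - t) + m2 ^+ 2 * t * (1 - t)
    + ((2 * S1 * S3 + (c + 3 / 2) * S4) * m2 - m1 ^+ 2)) =
  - ((c * S1 - q) * D ^+ 2
    + ((c + 1) * S2 - ((c + 1 / 2) * S1 + S1 ^+ 2)) * t * D ^+ 2
    + ((c + 2) * S3 - ((c + 3 / 2) * S2 + 2 * S1 * S2 - S1 ^+ 2)) * t ^+ 2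
      * (S3 ^+ 2 - 2 * S3 * S4 * t)
    + ((c + 3) * S4 - ((c + 5 / 2) * S3 + 2 * S1 * S3 + S2 ^+ 2 - 2 * S1 * S2))
      * t ^+ 3 * S3 ^+ 2).
  by rewrite /D /N /N' /m1 /m2; field.
by rewrite R2 R3 R4 R1 !subrr !mul0r !addr0 oppr0.
Qed.

(* On the left, the parenthesis is the derivative of 2 x p N - p1 D along p' = p1,
   p1' = p2, D' = 2 S4 x and N' = - 2 x (dN/dt), where [N'] stands for dN/dt. *)
Lemma barrier_ode (R : realFieldType) (c q x p p1 p2 D N N' S4 : R) :
  (1 - x ^+ 2) * p2 = 2 * c * x * p1 - 4 * q * p ->
  let t := 1 - x ^+ 2 in
  x * t * D * (- p2 * D - 2 * S4 * x * p1 + 2 * p * N + 2 * x * p1 * N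
    - 4 * x ^+ 2 * p * N') =
  (t * D + 2 * ((c - (c + 1 / 2) * t) * D + S4 * (x ^+ 2 * t) - x ^+ 2 * t * N)) *
    (2 * (x * p * N) - p1 * D) +
  4 * x * (t * (1 - t) * (N ^+ 2 - N' * D - S4 * N)
           - (c - (c + 1 / 2) * t) * N * D + q * D ^+ 2) * p.
Proof.
move=> ode t.
have -> : x * t * D * (- p2 * D - 2 * S4 * x * p1 + 2 * p * N + 2 * x * p1 * N
    - 4 * x ^+ 2 * p * N') =
  x * D * (- ((1 - x ^+ 2) * p2) * D + t * (- 2 * S4 * x * p1 + 2 * p * N
    + 2 * x * p1 * N - 4 * x ^+ 2 * p * N')).
  by rewrite /t; ring.
by rewrite ode /t; field.
Qed.

(** * Sign changes of polynomials over a real closed field *)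

(** Positive values must come down to 0 at the first zero, so the mean value theorem on [[y, z]]
    yields negative slopes arbitrarily close to the left of [z]. This rules out an increase just
    before [z]. *)
Lemma first_root_descent (R : rcfType) (p : {poly R}) (a b : R) :
  a < b -> 0 < p.[a] -> p.[b] = 0 ->
  exists z, [/\ a < z <= b, p.[z] = 0, forall x, a <= x < z -> 0 < p.[x] &
    forall y, a <= y < z -> exists2 x, y < x < z & p^`().[x] < 0].
Proof.
move=> ab pa pb.
have p0 : p != 0 by apply: contraTneq pa => ->; rewrite horner0 ltxx.
pose z := next_root p a b.
have az : a < z by exact: next_root_gt.
have zb : z <= b.
  by move: (next_root_in p a b); rewrite in_itv /= (max_l (ltW ab)) => /andP[].
have pz : p.[z] = 0.
  (* With no root strictly between [a] and [b], [next_root] defaults to their maximum, which is the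
     root [b]. *)
  rewrite /z; case: next_rootP => // [pE|_ _ ->].
    by rewrite pE eqxx in p0.
  by rewrite max_l // ltW.
have pos x : a <= x < z -> 0 < p.[x].
  move=> /andP[ax xz]; rewrite ltNge; apply/negP => px.
  have [|y] := @polyrcf.poly_ivt _ p a x ax; first by rewrite pmulr_rle0.
  rewrite in_itv /= => /andP[ay yx] /rootP py.
  have yNa : a != y by apply: contraTneq pa => ->; rewrite py ltxx.
  have : y \in `]a, z[ by rewrite in_itv /= lt_neqAle yNa ay (le_lt_trans yx).
  by move=> /(@next_noroot _ p a b); rewrite /root py eqxx.
exists z; split=> //; first by rewrite az.
move=> y /andP[ay yz]; have [x] := poly_mvt p yz.
rewrite in_itv /= pz sub0r => yxz E; exists x => //.
have := pos y; rewrite ay yz => /(_ isT); rewrite -oppr_lt0 E.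
by rewrite pmulr_llt0 // subr_gt0.
Qed.

Lemma poly_gt0_left (R : rcfType) (p : {poly R}) (a z : R) :
  a < z -> 0 < p.[z] -> exists2 y, a <= y < z & forall x, y < x < z -> 0 < p.[x].
Proof.
move=> az pz; have [d d0 pd] := poly_cont z p pz.
exists (Num.max a (z - d)) => [|x]; first by rewrite le_max lexx gt_max az /=; lra.
rewrite gt_max => /andP[/andP[_ zdx] xz].
have /pd : `|x - z| < d by rewrite ltr_norml; lra.
by rewrite ltr_norml; lra.
Qed.

(** * The barrier argument *)

(** Without a zero on [[a, 1]], [p] would be positive there and the barrier [G] would reach its
    first zero while increasing from positive values. The last inequality on the [S_i] makes the
    forcing term of [G] positive. *)
Lemma root_near_one (R : rcfType) (p : {poly R}) (c q S1 S2 S3 S4 : R) :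
  (forall x, (1 - x ^+ 2) * p^`()^`().[x] = 2 * c * x * p^`().[x] - 4 * q * p.[x]) ->
  0 < c -> 0 < p.[1] ->
  q = c * S1 -> (c + 1) * S2 = (c + 1 / 2) * S1 + S1 ^+ 2 ->
  (c + 2) * S3 = (c + 3 / 2) * S2 + 2 * S1 * S2 - S1 ^+ 2 ->
  (c + 3) * S4 = (c + 5 / 2) * S3 + 2 * S1 * S3 + S2 ^+ 2 - 2 * S1 * S2 ->
  0 < S3 -> S3 < S4 -> 0 <= S1 * S4 - S2 * S3 -> 0 <= S2 * S4 - S3 ^+ 2 ->
  (S1 * S4 - S2 * S3) ^+ 2 < (2 * S1 * S3 + (c + 3 / 2) * S4) * (S2 * S4 - S3 ^+ 2) ->
  exists x, [/\ 0 <= x, root p x & 1 - x ^+ 2 <= S3 / S4].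
Proof.
move=> ode c0 p1 R1 R2 R3 R4 S30 S34 m1 m2 key.
have S40 : 0 < S4 by lra.
have r1 : S3 / S4 < 1 by rewrite ltr_pdivrMr // mul1r.
(* At x = [a], t = 1 - x^2 is the pole [S3 / S4] of v, where [D] vanishes. *)
pose a := Num.sqrt (1 - S3 / S4).
have a2 : a ^+ 2 = 1 - S3 / S4 by rewrite sqr_sqrtr //; lra.
have a0 : 0 < a by rewrite sqrtr_gt0; lra.
have a1 : a < 1.
  by rewrite -(@ltr_pXn2r _ 2) ?nnegrE ?ltW // a2 expr1n ltrBlDr ltrDl divr_gt0.
have Da : S3 - S4 * (1 - a ^+ 2) = 0 by rewrite a2; field; lra.
have [[x /andP[ax x1] px]|noroot] := pselect (exists2 x, a <= x <= 1 & root p x).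
  exists x; split=> //; first by lra.
  have : a ^+ 2 <= x ^+ 2 by rewrite ler_pXn2r ?nnegrE //; lra.
  by rewrite a2; lra.
have pos x : a <= x <= 1 -> 0 < p.[x].
  move=> /andP[ax x1]; rewrite ltNge; apply/negP => px.
  have [|y] := @polyrcf.poly_ivt _ p x 1 x1; first by rewrite pmulr_lle0.
  rewrite in_itv /= => /andP[xy y1] py; apply: noroot; exists y => //.
  by rewrite y1 (le_trans ax).
pose T : {poly R} := 1 - 'X^2.
pose D : {poly R} := S3%:P - S4 *: T.
pose N : {poly R} :=
  (S1 * S3)%:P - (S1 * S4 - S2 * S3) *: T - (S2 * S4 - S3 ^+ 2) *: T ^+ 2.
(* The derivative in x is -2 x times the derivative in t, so this is 2 x (f' D + f N). *)
pose G := 2 *: ('X * p * N) - p^`() * D.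
pose L : {poly R} := c%:P - (c + 1 / 2) *: T.
(* [A] is the coefficient of [G] in its first-order equation [GE]; [e t] is the right-hand side of
   [riccati_defect] divided by [t ^+ 4]. *)
pose A := T * D + 2 *: (L * D + S4 *: ('X^2 * T) - 'X^2 * T * N).
pose e t := 2 * (S1 * S4 - S2 * S3) * (S2 * S4 - S3 ^+ 2) * (1 - t)
  + (S2 * S4 - S3 ^+ 2) ^+ 2 * t * (1 - t)
  + ((2 * S1 * S3 + (c + 3 / 2) * S4) * (S2 * S4 - S3 ^+ 2) - (S1 * S4 - S2 * S3) ^+ 2).
have DE x : D.[x] = S3 - S4 * (1 - x ^+ 2) by rewrite /D /T !hornerE.
have NE x : N.[x] = S1 * S3 - (S1 * S4 - S2 * S3) * (1 - x ^+ 2)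
    - (S2 * S4 - S3 ^+ 2) * (1 - x ^+ 2) ^+ 2.
  by rewrite /N /T !hornerE.
have AE x : A.[x] = (1 - x ^+ 2) * D.[x] + 2 * ((c - (c + 1 / 2) * (1 - x ^+ 2)) * D.[x]
    + S4 * (x ^+ 2 * (1 - x ^+ 2)) - x ^+ 2 * (1 - x ^+ 2) * N.[x]).
  by rewrite DE NE /A /L /D /N /T !hornerE.
have GVE x : G.[x] = 2 * (x * p.[x] * N.[x]) - p^`().[x] * D.[x].
  by rewrite DE NE /G /D /N /T !hornerE.
have GE x : x * (1 - x ^+ 2) * D.[x] * G^`().[x] =
    A.[x] * G.[x] + 4 * x * (1 - x ^+ 2) ^+ 4 * e (1 - x ^+ 2) * p.[x].
  have dG : G^`().[x] = - p^`()^`().[x] * D.[x] - 2 * S4 * x * p^`().[x] + 2 * p.[x] * N.[x]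
      + 2 * x * p^`().[x] * N.[x] - 4 * x ^+ 2 * p.[x]
        * (- (S1 * S4 - S2 * S3) - 2 * (S2 * S4 - S3 ^+ 2) * (1 - x ^+ 2)).
    by rewrite DE NE /G /D /N /T !derivE !hornerE /=; ring.
  rewrite dG (barrier_ode D.[x] N.[x] _ S4 (ode x)) AE GVE; congr (_ + _); rewrite DE NE.
  by rewrite (riccati_defect (1 - x ^+ 2) R1 R2 R3 R4) /e; ring.
have Ga : 0 < G.[a].
  rewrite GVE DE Da mulr0 subr0 NE a2.
  have := pos a; rewrite lexx (ltW a1) => /(_ isT) pa.
  rewrite !pmulr_rgt0 //.
  have -> : S1 * S3 - (S1 * S4 - S2 * S3) * (1 - (1 - S3 / S4))
      - (S2 * S4 - S3 ^+ 2) * (1 - (1 - S3 / S4)) ^+ 2 =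
    S3 * (S3 / S4) ^+ 2 * S3 by field; lra.
  by rewrite !mulr_gt0 // invr_gt0.
(* At x = 1 the equation degenerates to p'(1) = 2 S1 p(1): u and v agree at t = 0. *)
have G1 : G.[1] = 0.
  have := ode 1; rewrite expr1n subrr mul0r GVE DE NE expr1n subrr => o.
  have : c * p^`().[1] = c * (2 * S1 * p.[1]) by rewrite R1 in o; lra.
  by move=> /(mulfI (lt0r_neq0 c0)) ->; ring.
have [z [/andP[az z1] Gz Gpos Gdes]] := first_root_descent a1 Ga G1.
have Dpos x : a < x -> 0 < D.[x].
  move=> ax; rewrite DE -Da ltrD2l ltrN2 ltr_pM2l // ltrD2l ltrN2.
  by rewrite ltr_pXn2r ?nnegrE //; lra.
have epos x : a < x < 1 -> 0 < 4 * x * (1 - x ^+ 2) ^+ 4 * e (1 - x ^+ 2) * p.[x].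
  move=> /andP[ax x1].
  have px : 0 < p.[x] by apply: pos; lra.
  have x20 : 0 < x ^+ 2 by rewrite exprn_gt0 //; lra.
  have x21 : 0 < 1 - x ^+ 2 by rewrite subr_gt0 expr_lt1 //; lra.
  have : 0 < e (1 - x ^+ 2).
    rewrite /e; apply: ltr_wpDl; last by rewrite subr_gt0.
    by apply: addr_ge0; rewrite !mulr_ge0 ?sqr_ge0 //; lra.
  by move=> ?; rewrite !mulr_gt0 ?exprn_gt0 //; lra.
have G'pos x : a < x < 1 -> 0 <= A.[x] * G.[x] -> 0 < G^`().[x].
  move=> ax1 AG; have /andP[ax x1] := ax1.
  have x21 : 0 < 1 - x ^+ 2 by rewrite subr_gt0 expr_lt1 //; lra.
  have : 0 < x * (1 - x ^+ 2) * D.[x] * G^`().[x].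
    by rewrite GE ltr_wpDl // epos.
  by rewrite pmulr_rgt0 // !mulr_gt0 ?Dpos //; lra.
suff [y yz yG] : exists2 y, a <= y < z & forall x, y < x < z -> 0 < G^`().[x].
  by have [x /yG + /ltW] := Gdes y yz; rewrite ltNge => /negP.
(* If z < 1, [GE] gives G'(z) > 0, which persists to the left by continuity. If z = 1, both sides of
   [GE] vanish there; instead A(1) = 2 c S3 > 0, so [A] and [G] are both positive just left of 1. *)
case: (ltgtP z 1) z1 => // [z1|z1] _.
  by apply: poly_gt0_left => //; apply: G'pos; rewrite ?az // Gz mulr0.
have A1 : 0 < A.[z].
  rewrite z1 AE DE expr1n subrr !(mulr0, mul0r, subr0, addr0, add0r).
  by rewrite !mulr_gt0.
have [y /andP[ay yz] Ay] := poly_gt0_left az A1.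
exists y => [|x yxz]; first by rewrite ay.
have /andP[yx xz] := yxz; apply: G'pos; first by rewrite -z1; lra.
by rewrite ltW // mulr_gt0 ?Ay // Gpos //; lra.
Qed.

(** * Explicit coefficients of the Riccati solution and their inequalities *)

Local Ltac positive :=
  repeat first [ assumption | by rewrite ltr0n | apply: addr_gt0 | apply: mulr_gt0
               | apply: exprn_gt0 | rewrite invr_gt0 ].

(* The S_i are determined by the recurrences; [T2], [T3], [T4] are their numerators
   and [k] is the common factor of the determinants S1 S4 - S2 S3 and
   S2 S4 - S3^2, which vanish for n = 1, 2. The
   strict inequality in the middle follows from [k <= q ^+ 2], [V ^+ 2 < 9 * U] and
   [9 * q ^+ 3 * (c + 1) * (c + 2) < H]. *)
Lemma riccati_coefficients (R : realFieldType) (c q : R) : 0 < c -> c + 1 / 2 < q ->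
  exists S1 S2 S3 S4,
  [/\ q = c * S1, (c + 1) * S2 = (c + 1 / 2) * S1 + S1 ^+ 2,
      (c + 2) * S3 = (c + 3 / 2) * S2 + 2 * S1 * S2 - S1 ^+ 2 &
      (c + 3) * S4 = (c + 5 / 2) * S3 + 2 * S1 * S3 + S2 ^+ 2 - 2 * S1 * S2] /\
  [/\ [/\ 0 < S3, 0 < S4, 0 <= S1 * S4 - S2 * S3 & 0 <= S2 * S4 - S3 ^+ 2],
      (S1 * S4 - S2 * S3) ^+ 2 <
        (2 * S1 * S3 + (c + 3 / 2) * S4) * (S2 * S4 - S3 ^+ 2) &
      S3 / S4 < 8 * c * (c + 1) * (c + 3) / ((5 * c + 6) * (4 * q + c ^+ 2 / 2))].
Proof.
move=> c0 cq; have q0 : 0 < q by lra.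
pose T2 := c ^+ 2 + c / 2 + q.
pose T3 := c ^+ 4 + 2 * c ^+ 3 + 3 / 4 * c ^+ 2 + (2 * c ^+ 2 + 3 / 2 * c) * q
  + 2 * q ^+ 2.
pose T4 := c ^+ 7 + 11 / 2 * c ^+ 6 + 41 / 4 * c ^+ 5 + 61 / 8 * c ^+ 4 + 15 / 8 * c ^+ 3
  + (3 * c ^+ 5 + 21 / 2 * c ^+ 4 + 11 * c ^+ 3 + 15 / 4 * c ^+ 2) * q
  + (6 * c ^+ 3 + 13 * c ^+ 2 + 6 * c) * q ^+ 2 + (5 * c + 6) * q ^+ 3.
pose U := c ^+ 4 + 3 * c ^+ 3 + 11 / 4 * c ^+ 2 + 3 / 4 * c
  + (3 * c ^+ 2 + 7 * c + 9 / 2) * q + q ^+ 2.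
pose V := 2 * c ^+ 2 + 3 * c + 3 * q.
pose k := (q - c / 2) * (q - c - 1 / 2).
have k0 : 0 < k by rewrite mulr_gt0; lra.
have kq : k <= q ^+ 2.
  rewrite -subr_ge0 /k.
  have -> : q ^+ 2 - (q - c / 2) * (q - c - 1 / 2) =
    (3 * c + 1) / 2 * (q - (c + 1 / 2)) + c ^+ 2 + c + 1 / 4 by field.
  have : 0 < (3 * c + 1) / 2 * (q - (c + 1 / 2)) by rewrite mulr_gt0; lra.
  have : 0 < c ^+ 2 by rewrite exprn_gt0.
  by lra.
have T30 : 0 < T3 by rewrite /T3; positive.
have T40 : 0 < T4 by rewrite /T4; positive.
have U0 : 0 < U by rewrite /U; positive.
have V0 : 0 < V by rewrite /V; positive.
have c1 : 0 < c + 1 by lra.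
have c2 : 0 < c + 2 by lra.
have c3 : 0 < c + 3 by lra.
have VU : V ^+ 2 < 9 * U.
  rewrite -subr_gt0.
  have -> : 9 * U - V ^+ 2 = 5 * c ^+ 4 + 15 * c ^+ 3 + 63 / 4 * c ^+ 2 + 27 / 4 * c
    + (15 * c ^+ 2 + 45 * c + 81 / 2) * q by rewrite /U /V; field.
  by positive.
pose H := 2 * q * T3 * (c + 1) * (c + 3) + (c + 3 / 2) * T4.
have Hq : 9 * q ^+ 3 * (c + 1) * (c + 2) < H.
  rewrite -subr_gt0.
  (* The top powers of [q] in [T3] and [T4] contribute 4 (c + 1) (c + 3) + (c + 3/2) (5 c + 6) to
     the coefficient of q^3, which exceeds 9 (c + 1) (c + 2) by 5 c / 2 + 3. *)
  have -> : H - 9 * q ^+ 3 * (c + 1) * (c + 2) =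
    (5 / 2 * c + 3) * q ^+ 3
    + 2 * q * (T3 - 2 * q ^+ 2) * (c + 1) * (c + 3)
    + (c + 3 / 2) * (T4 - (5 * c + 6) * q ^+ 3).
    by rewrite /H; field.
  have -> : T3 - 2 * q ^+ 2 =
    c ^+ 4 + 2 * c ^+ 3 + 3 / 4 * c ^+ 2 + (2 * c ^+ 2 + 3 / 2 * c) * q.
    by rewrite /T3; ring.
  rewrite /T4 addrK.
  by positive.
have HU : 0 < H * U - q * k * (c + 1) * (c + 2) * V ^+ 2.
  rewrite subr_gt0.
  have P0 : 0 < q ^+ 3 * (c + 1) * (c + 2) by rewrite !(mulr_gt0, exprn_gt0).
  apply: (@le_lt_trans _ _ (q ^+ 3 * (c + 1) * (c + 2) * V ^+ 2)).
    rewrite ler_pM2r ?exprn_gt0 // !ler_pM2r //.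
    by rewrite [leRHS]exprS ler_pM2l.
  apply: (@lt_trans _ _ (q ^+ 3 * (c + 1) * (c + 2) * (9 * U))).
    by rewrite ltr_pM2l.
  have -> : q ^+ 3 * (c + 1) * (c + 2) * (9 * U) = 9 * q ^+ 3 * (c + 1) * (c + 2) * U by ring.
  by rewrite ltr_pM2r.
have cN : c != 0 by lra.
have c1N : c + 1 != 0 by lra.
have c2N : c + 2 != 0 by lra.
have c3N : c + 3 != 0 by lra.
pose S1 := q / c.
pose S2 := q * T2 / (c ^+ 2 * (c + 1)).
pose S3 := q * T3 / (c ^+ 3 * (c + 1) * (c + 2)).
pose S4 := q * T4 / (c ^+ 4 * (c + 1) ^+ 2 * (c + 2) * (c + 3)).
have m1E : S1 * S4 - S2 * S3 = q ^+ 2 * k * V / (c ^+ 4 * (c + 1) ^+ 2 * (c + 2) * (c + 3)).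
  by rewrite /S1 /S2 /S3 /S4 /T2 /T3 /T4 /k /V; field; rewrite ?cN ?c1N ?c2N ?c3N.
have m2E : S2 * S4 - S3 ^+ 2 =
    q ^+ 2 * k * U / (c ^+ 4 * (c + 1) ^+ 3 * (c + 2) ^+ 2 * (c + 3)).
  by rewrite /S2 /S3 /S4 /T2 /T3 /T4 /k /U; field; rewrite ?cN ?c1N ?c2N ?c3N.
have S30 : 0 < S3 by rewrite /S3; positive.
have S40 : 0 < S4 by rewrite /S4; positive.
(* This trades [S3 / S4] for the simpler bound. The q^3 terms cancel, and the only negative monomial
   of the difference, - c^5 q, is absorbed by a square. *)
have TT : T3 * ((5 * c + 6) * (4 * q + c ^+ 2 / 2)) < 8 * T4.
  rewrite -subr_gt0.
  have -> : 8 * T4 - T3 * ((5 * c + 6) * (4 * q + c ^+ 2 / 2)) =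
    c ^+ 3 * (2 * q ^+ 2 + (q - c ^+ 2 / 2) ^+ 2) + 21 / 4 * c ^+ 7 + 36 * c ^+ 6
    + 593 / 8 * c ^+ 5 + 235 / 4 * c ^+ 4 + 15 * c ^+ 3
    + (41 / 4 * c ^+ 4 + 41 / 2 * c ^+ 3 + 12 * c ^+ 2) * q
    + (20 * c ^+ 2 + 12 * c) * q ^+ 2 by rewrite /T3 /T4; field.
  have : 0 < 2 * q ^+ 2 + (q - c ^+ 2 / 2) ^+ 2.
    by rewrite ltr_pwDl ?sqr_ge0 //; positive.
  by move=> ?; positive.
exists S1, S2, S3, S4; split; split.
- by rewrite /S1; field.
- by rewrite /S1 /S2 /T2; field; rewrite ?cN ?c1N.
- by rewrite /S1 /S2 /S3 /T3 /T2; field; rewrite ?cN ?c1N ?c2N.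
- by rewrite /S1 /S2 /S3 /S4 /T4 /T3 /T2; field; rewrite ?cN ?c1N ?c2N ?c3N.
- by split; rewrite ?m1E ?m2E //; apply: ltW; positive.
- have HE : 2 * S1 * S3 + (c + 3 / 2) * S4 =
    q * H / (c ^+ 4 * (c + 1) ^+ 2 * (c + 2) * (c + 3)).
    by rewrite /H /S1 /S3 /S4; field; rewrite ?cN ?c1N ?c2N ?c3N.
  rewrite HE m1E m2E -subr_gt0.
  have -> : q * H / (c ^+ 4 * (c + 1) ^+ 2 * (c + 2) * (c + 3))
      * (q ^+ 2 * k * U / (c ^+ 4 * (c + 1) ^+ 3 * (c + 2) ^+ 2 * (c + 3)))
      - (q ^+ 2 * k * V / (c ^+ 4 * (c + 1) ^+ 2 * (c + 2) * (c + 3))) ^+ 2 =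
    q ^+ 3 * k * (H * U - q * k * (c + 1) * (c + 2) * V ^+ 2)
      / (c ^+ 8 * (c + 1) ^+ 5 * (c + 2) ^+ 3 * (c + 3) ^+ 2).
    by field; rewrite ?cN ?c1N ?c2N ?c3N.
  by positive.
- have -> : S3 / S4 = T3 * (c * (c + 1) * (c + 3)) / T4.
    rewrite /S3 /S4; field.
    by rewrite ?cN ?c1N ?c2N ?c3N ?(lt0r_neq0 q0) ?(lt0r_neq0 T40).
  have B0 : 0 < (5 * c + 6) * (4 * q + c ^+ 2 / 2) by positive.
  rewrite ltr_pdivrMr // [ltRHS]mulrAC ltr_pdivlMr //.
  have -> : 8 * c * (c + 1) * (c + 3) * T4 = 8 * T4 * (c * (c + 1) * (c + 3)) by ring.
  by rewrite mulrAC ltr_pM2r //; positive.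
Qed.

(** * Differential equation and value at 1 of the Gegenbauer polynomials *)

Lemma pochhammerS (R : realType) (a : R) (k : nat) :
  pochhammer a k.+1 = pochhammer a k * (a + k%:R).
Proof. exact: big_ord_recr. Qed.

Lemma pochhammer_gt0 (R : realType) (a : R) (k : nat) : 0 < a -> 0 < pochhammer a k.
Proof. by move=> a0; apply: prodr_gt0 => i _; rewrite ltr_wpDr. Qed.

Lemma pochhammer_oppn_eq0 (R : realType) (n k : nat) :
  (n < k)%N -> pochhammer (- n%:R : R) k = 0.
Proof.
move=> nk; rewrite /pochhammer (bigD1 (Ordinal nk)) //=.
by rewrite addNr mul0r.
Qed.

(** Gauss's equation with first parameter -n; comparing coefficients reduces it to the ratio [aS] of
    consecutive ones. *)
Lemma hypergeometric_ode (R : realType) (n : nat) (b c : R) : 0 < c ->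
  let F := \poly_(k < n.+1)
    (pochhammer (- n%:R) k * pochhammer b k / (k`!%:R * pochhammer c k)) in
  'X * (1 - 'X) * F^`()^`() + (c%:P - (b + 1 - n%:R) *: 'X) * F^`()
    + (n%:R * b) *: F = 0.
Proof.
move=> c0 F.
pose a k : R := pochhammer (- n%:R) k * pochhammer b k / (k`!%:R * pochhammer c k).
(* The formula also holds past [n], where [pochhammer (- n%:R) k] is 0. *)
have Fk k : F`_k = a k.
  rewrite coef_poly; case: ltnP => // nk.
  by rewrite /a pochhammer_oppn_eq0 ?mul0r.
have aS k : (k.+1%:R * (c + k%:R)) * a k.+1 = (k%:R - n%:R) * (b + k%:R) * a k.
  rewrite /a !pochhammerS factS natrM; field.
  have := pochhammer_gt0 k c0; have : (0 : R) < k`!%:R by rewrite ltr0n fact_gt0.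
  have : (0 : R) <= k%:R by [].
  by move=> *; lra.
have -> : 'X * (1 - 'X) * F^`()^`() + (c%:P - (b + 1 - n%:R) *: 'X) * F^`()
    + (n%:R * b) *: F =
  'X * F^`()^`() - 'X * ('X * F^`()^`()) + c *: F^`() - (b + 1 - n%:R) *: ('X * F^`())
    + (n%:R * b) *: F.
  by rewrite -!mul_polyC; ring.
apply/polyP => k; rewrite coef0.
rewrite !(coefD, coefN, coefXM, coefZ) !coef_deriv !Fk.
clearbody F a.
have /eqP := aS k; rewrite -subr_eq0 => /eqP.
case: k => [|[|k]] /= aSk; rewrite -[RHS]aSk.
- by ring.
- by ring.
- by ring.
Qed.
Lemma jacobiE (R : realType) (n : nat) (a b : R) :
  jacobi n a b = (pochhammer (a + 1) n / n`!%:R) *: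
    (\poly_(k < n.+1) (pochhammer (- n%:R) k * pochhammer (n%:R + a + b + 1) k
       / (k`!%:R * pochhammer (a + 1) k)) \Po (2^-1 *: (1 - 'X))).
Proof.
rewrite /jacobi; congr (_ *: _); rewrite poly_def raddf_sum; apply: eq_bigr => k _.
by rewrite /= comp_polyZ comp_Xn_poly.
Qed.

(** Gauss's equation at y = (1 - x) / 2, where y (1 - y) = (1 - x^2) / 4, with parameters -n, n + 2
    l and l + 1/2. *)
Lemma gegenbauer_ode (R : realType) (n : nat) (l : R) (x : R) : - 2^-1 < l ->
  let p := gegenbauer n l in
  (1 - x ^+ 2) * p^`()^`().[x] =
    (2 * l + 1) * x * p^`().[x] - n%:R * (n%:R + 2 * l) * p.[x].
Proof.
move=> hl; rewrite /gegenbauer jacobiE; set C := _ / _; set F := \poly_(_ < _) _.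
have c0 : 0 < l - 2^-1 + 1 by lra.
have /(congr1 (horner^~ (2^-1 * (1 - x)))) /= :=
  hypergeometric_ode n (n%:R + (l - 2^-1) + (l - 2^-1) + 1) c0.
rewrite -/F; clearbody F C => o.
rewrite !(derivZ, deriv_comp, derivM) !derivE /= !hornerE !horner_comp !hornerE /=.
move: o; rewrite !hornerE /= => o; apply/eqP; rewrite -subr_eq0; apply/eqP.
by apply: etrans (etrans (congr1 ( *%R C) o) (mulr0 C)); field.
Qed.

Lemma gegenbauer1_gt0 (R : realType) (n : nat) (l : R) : - 2^-1 < l ->
  0 < (gegenbauer n l).[1].
Proof.
move=> hl; have c0 : 0 < l - 2^-1 + 1 by lra.
rewrite /gegenbauer jacobiE hornerZ horner_comp !hornerE subrr mulr0.
rewrite horner_coef0 coef_poly /= /pochhammer !big_ord0 fact0 !mulr1 divr1 mulr1.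
by rewrite divr_gt0 ?pochhammer_gt0 // ltr0n fact_gt0.
Qed.

(** * From a zero near 1 to the largest zero *)

Lemma le_largest_zero (R : realType) (p : {poly R}) (x : R) :
  p != 0 -> root p x -> x <= largest_zero p.
Proof.
move=> p0 px; apply: ub_le_sup => //; exists (cauchy_bound p) => y /rootP py.
by rewrite ltW // (le_lt_trans (ler_norm y)) // cauchy_boundP.
Qed.

Theorem corollary4 (R : realType) (n : nat) (l : R)
    (hn : (4 <= n)%N) (hl : - 2^-1 < l) :
  1 - (largest_zero (gegenbauer n l)) ^+ 2 <
  (2 * (2 * l + 1) * (2 * l + 3) * (2 * l + 7)) /
  ((10 * l + 17) * (n%:R * (n%:R + 2 * l) + 8^-1 * (2 * l + 1) ^+ 2)).
Proof.
set p := gegenbauer n l; pose c := l + 2^-1; pose q : R := n%:R * (n%:R + 2 * l) / 4.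
have c0 : 0 < c by rewrite /c; lra.
have n4 : (4 : R) <= n%:R by rewrite ler_nat.
have cq : c + 1 / 2 < q.
  rewrite /c /q ltr_pdivlMr //.
  have : 4 * (4 + 2 * l) <= n%:R * (n%:R + 2 * l) by apply: ler_pM; lra.
  by lra.
have [S1 [S2 [S3 [S4 [[R1 R2 R3 R4] [[S30 S40 m1 m2] key bound]]]]]] :=
  riccati_coefficients c0 cq.
have -> : (2 * (2 * l + 1) * (2 * l + 3) * (2 * l + 7)) /
    ((10 * l + 17) * (n%:R * (n%:R + 2 * l) + 8^-1 * (2 * l + 1) ^+ 2)) =
  8 * c * (c + 1) * (c + 3) / ((5 * c + 6) * (4 * q + c ^+ 2 / 2)).
  have -> : 4 * q + c ^+ 2 / 2 = n%:R * (n%:R + 2 * l) + 8^-1 * (2 * l + 1) ^+ 2.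
    by rewrite /q /c; field.
  have -> : 5 * c + 6 = (10 * l + 17) / 2 by rewrite /c; field.
  have K0 : n%:R * (n%:R + 2 * l) + 8^-1 * (2 * l + 1) ^+ 2 != 0.
    have : 0 < n%:R * (n%:R + 2 * l) by rewrite mulr_gt0; lra.
    by have := sqr_ge0 (2 * l + 1); lra.
  rewrite /c; move: K0; set K := _ + _ * _ => K0.
  by field; rewrite K0 /=; lra.
(* If [S4 <= S3], then [S3 / S4] is at least 1 and the bound is trivial; otherwise the barrier
   argument applies. *)
apply: le_lt_trans bound; case: (ltP S3 S4) => [S34|S43]; last first.
  have : 1 <= S3 / S4 by rewrite ler_pdivlMr // mul1r.
  by have := sqr_ge0 (largest_zero p); lra.
have p1 := gegenbauer1_gt0 n hl.
have ode x : (1 - x ^+ 2) * p^`()^`().[x] = 2 * c * x * p^`().[x] - 4 * q * p.[x].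
  by rewrite gegenbauer_ode // /c /q; field.
have [x [x0 px]] := root_near_one ode c0 p1 R1 R2 R3 R4 S30 S34 m1 m2 key.
have p0 : p != 0 by apply: contraTneq p1 => pE; rewrite -/p pE horner0 ltxx.
have xp := le_largest_zero p0 px.
have : x ^+ 2 <= largest_zero p ^+ 2 by rewrite ler_pXn2r ?nnegrE //; lra.
by lra.
Qed.
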